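(* Let $B$ and $B'$ be two sets of patterns (permutations) with $|B| = |B'|$, each containing no redundancies. Suppose there is some labeling of their elements, say $B = \{p_1,\ldots,p_k\}$ and $B' = \{p_1',\ldots,p_k'\}$, such that $|p_i| = |p_i'|$ for $1 \le i \le k$, and $\mathrm{OverlapMaps}(p_i,p_j) = \mathrm{OverlapMaps}(p_i',p_j')$ for all $1 \le i,j \le k$. Then $B$ and $B'$ are strongly c-Wilf-Equivalent, i.e. $P_B(z,t) = P_{B'}(z,t)$.
   Context: For a sequence $\sigma=\sigma_1\cdots\sigma_k$ of distinct positive integers, the reduction $\rho(\sigma)$ is the permutation of $\{1,\ldots,k\}$ whose entries are in the same relative order as those of $\sigma$. For a permutation $p$, $|p|$ denotes its length. A permutation $\sigma\in\mathcal{S}_n$ contains $p \in \mathcal{S}_m$ (with $m\le n$) consecutively if $\rho(\sigma_i\cdots\sigma_{i+m-1})=p$ for some $1\le i\le n-m+1$; each such $i$ is an occurrence of $p$ in $\sigma$. A set $B$ of permutations contains no redundancies if there are no $p,q\in B$ with $p\ne q$ such that $p$ contains $q$ consecutively. For a set $B$ of permutations, let $b_{k,n}$ be the number of permutations of length $n$ containing exactly $k$ consecutive occurrences (in total) of the patterns in $B$, and define $P_B(z,t)=\sum_{k,n\ge 0} b_{k,n}\frac{z^n t^k}{n!}$. Two sets $B,B'$ are strongly c-Wilf-Equivalent if $P_B(z,t)=P_{B'}(z,t)$. For permutations $\pi=\pi_1\cdots\pi_m$ and $\sigma=\sigma_1\cdots\sigma_n$ (not necessarily distinct) and an integer $j$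 with $1\le j<\min(m,n)$ such that $\rho(\sigma_{n-j+1}\cdots\sigma_n)=\rho(\pi_1\cdots\pi_j)$, define $$\mathrm{OverlapMap}(\sigma,\pi,j)=\{(\pi_1,\sigma_{n-j+1}),(\pi_2,\sigma_{n-j+2}),\ldots,(\pi_j,\sigma_n)\},$$ and define $$\mathrm{OverlapMaps}(\sigma,\pi)=\{\mathrm{OverlapMap}(\sigma,\pi,j) : 1\le j<\min(m,n),\ \rho(\sigma_{n-j+1}\cdots\sigma_n)=\rho(\pi_1\cdots\pi_j)\}.$$ For example, $\mathrm{OverlapMaps}(2143,2143)=\{\{(2,3)\},\{(2,4),(1,3)\}\}$. *)

(* Defs.v *)
From mathcomp Require Import all_boot all_order all_algebra.
From mathcomp Require Import finmap.

Set Implicit Arguments.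
Unset Strict Implicit.
Unset Printing Implicit Defensive.

Import GRing.Theory.
Local Open Scope fset_scope.

(* Permutations are words in one-line notation over 1, ..., n. *)
Definition is_perm (p : seq nat) : bool := perm_eq p (iota 1 (size p)).

(* Every entry is replaced by its rank, counted from 1, among the entries. *)
Definition rho (s : seq nat) : seq nat :=
  [seq count (fun y => y <= x) s | x <- s].

(* For s without repetitions, the next two lemmas say that rho s is the
   permutation whose entries are in the same relative order as those of s. *)
Lemma rho_le (s : seq nat) (i j : nat) : i < size s -> j < size s ->
  (nth 0 (rho s) i <= nth 0 (rho s) j) = (nth 0 s i <= nth 0 s j).
Proof.
move=> lti ltj; rewrite !(nth_map 0) //.
set x := nth 0 s i; set y := nth 0 s j.
have [le_xy|lt_yx] := leqP x y.
  by apply: sub_count => z /= /leq_trans; apply.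
apply/negbTE; rewrite -ltnNge.
have xs : x \in s by rewrite mem_nth.
clearbody x y; elim: s xs {lti ltj i j} => //= z s IHs.
have le_s : count (leq^~ y) s <= count (leq^~ x) s.
  by apply: sub_count => t /= le_ty; apply: leq_trans (ltnW lt_yx).
have le_z : (z <= y) <= (z <= x).
  by case: (leqP z y) => // /leq_trans/(_ (ltnW lt_yx)) ->.
rewrite inE => /orP[/eqP xz|/IHs lt_s]; last by rewrite -addnS leq_add.
by rewrite -xz leqnn [x <= y]leqNgt lt_yx.
Qed.

Lemma rho_is_perm (s : seq nat) : uniq s -> is_perm (rho s).
Proof.
move=> Us; have Ur : uniq (rho s).
  apply/(uniqP 0) => i j; rewrite !inE size_map => lti ltj eq_ij.
  apply/eqP; rewrite -(nth_uniq 0 lti ltj Us) eqn_leq.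
  by rewrite -(rho_le lti ltj) -(rho_le ltj lti) eq_ij leqnn.
have sub : {subset rho s <= iota 1 (size (rho s))}.
  move=> _ /mapP[x xs ->]; rewrite mem_iota size_map; apply/andP; split.
    by rewrite -has_count; apply/hasP; exists x.
  by rewrite add1n; apply: count_size.
have [] := uniq_min_size Ur sub; first by rewrite size_iota.
by move=> _ eq_r; apply: uniq_perm => //; apply: iota_uniq.
Qed.

(* The positions i with 1 <= i <= n - m + 1, where n = size s, m = size p;
   the range is empty when m > n. *)
Definition occurrences (p s : seq nat) : seq nat :=
  [seq i <- iota 1 ((size s).+1 - size p)
     | rho (take (size p) (drop i.-1 s)) == p].

Definition contains (s p : seq nat) : Prop := exists i, i \in occurrences p s.

Definition no_redundancies (B : {fset seq nat}) : Prop :=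
  ~ (exists p q, [/\ p \in B, q \in B, p <> q & contains p q]).

Definition num_occurrences (B : {fset seq nat}) (s : seq nat) : nat :=
  \sum_(p <- B) size (occurrences p s).

Definition num_perms (B : {fset seq nat}) (k n : nat) : nat :=
  count (fun s => num_occurrences B s == k) (permutations (iota 1 n)).

(* A formal power series in z and t over the rationals is given by its
   coefficients: P_series B n k is the coefficient of z^n t^k. *)
Definition P_series (B : {fset seq nat}) : nat -> nat -> rat :=
  fun n k => ((num_perms B k n)%:R / (n`!)%:R)%R.

Definition strongly_cWilf_equivalent (B B' : {fset seq nat}) : Prop :=
  P_series B = P_series B'.

Definition OverlapMap (sigma pi : seq nat) (j : nat) : {fset nat * nat} :=
  [fset x in zip (take j pi) (drop (size sigma - j) sigma)].

(* Here j ranges over 1 <= j < min (size pi) (size sigma). *)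
Definition OverlapMaps (sigma pi : seq nat) : {fset {fset nat * nat}} :=
  [fset x in [seq OverlapMap sigma pi j
               | j <- iota 1 (minn (size pi) (size sigma)).-1
               & rho (drop (size sigma - j) sigma) == rho (take j pi)]].

Example OverlapMaps_2143 :
  OverlapMaps [:: 2; 1; 4; 3] [:: 2; 1; 4; 3] =
    [fset [fset (2, 3)]; [fset (2, 4); (1, 3)]].
Proof.
have OM1 : OverlapMap [:: 2; 1; 4; 3] [:: 2; 1; 4; 3] 1 = [fset (2, 3)].
  by apply/fsetP => y; rewrite /OverlapMap !inE ?orbF.
have OM2 :
    OverlapMap [:: 2; 1; 4; 3] [:: 2; 1; 4; 3] 2 = [fset (2, 4); (1, 3)].
  by apply/fsetP => y; rewrite /OverlapMap !inE ?orbF.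
by apply/fsetP => x; rewrite /OverlapMaps /= OM1 OM2 !inE ?orbF.
Qed.

(* Main.v *)
Require Import Defs.
From mathcomp Require Import all_boot all_order all_algebra.
From mathcomp Require Import finmap zify.
From mathcomp Require boolp.

(** Why the theorem holds.  Call a pair (a, i), made of a pattern and a position,
    a mark, and let the marks of a permutation s of length n be the pairs such
    that p a occurs in s at position i.  The number of occurrences in s is the
    number of marks of s, so it is enough that the set of marks has the same
    distribution over the permutations of length n for the two families p and q
    ([perm_eq_marks]).  By inclusion-exclusion ([perm_eq_of_upsets]) it is even
    enough that, for every set A of marks, as many permutations have all of A
    among their marks for p as for q ([leq_count_marks], used in both
    directions).

    To carry p-occurrences at the marks of A to q-occurrences, positions are
    relabelled: inside the window of a mark (a, i), the position that holds the
    value v of p a is sent to the position that holds v in q a ([move_in]).  The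
    only difficulty is a position that lies in the windows of two marks, where
    the two prescriptions have to agree.  If one window contained the other,
    then one pattern would contain the other, which the absence of redundancies
    excludes.  So the windows overlap properly, and since both patterns occur in
    a common permutation, the overlap gives a member of OverlapMaps
    ([occurrences_linked]).  That map says exactly which value of the one pattern
    sits at the same position as a given value of the other, and as p and q have
    the same overlap maps, the two prescriptions agree ([linked_move_in]).  The
    relabelling built for (q, p) inverts the one built for
    (p, q), hence permuting entries along it is injective. *)

Set Implicit Arguments.
Unset Strict Implicit.
Unset Printing Implicit Defensive.

Local Open Scope fset_scope.

(** * Occurrences as order isomorphisms *)

Definition order_iso (s t : seq nat) : Prop :=
  size s = size t /\
  {in [pred i | i < size s] &, forall i j,
    (nth 0 s i <= nth 0 s j) = (nth 0 t i <= nth 0 t j)}.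

(** Reductions are easy to compare but hard to compute with; every later argument
    about occurrences goes through the relative order of entries instead. *)
Lemma rho_order_iso (s t : seq nat) : rho s = rho t <-> order_iso s t.
Proof.
split=> [eq_rho | [eq_size eq_le]].
  have eq_size : size s = size t.
    by have := congr1 size eq_rho; rewrite !size_map.
  split=> // i j; rewrite !inE => lti ltj.
  by rewrite -(rho_le lti ltj) eq_rho rho_le -?eq_size.
apply: (@eq_from_nth _ 0); rewrite !size_map // => i lti.
rewrite !(nth_map 0) -?eq_size //.
have count_iota r x :
    count (leq^~ x) r = count (fun j => nth 0 r j <= x) (iota 0 (size r)).
  by rewrite -[in LHS](mkseq_nth 0 r) count_map.
rewrite !count_iota -eq_size; apply: eq_in_count => j.
by rewrite mem_iota => ltj; apply: eq_le.
Qed.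

Lemma rho_perm (p : seq nat) : is_perm p -> rho p = p.
Proof.
move=> perm_p; apply: (@eq_from_nth _ 0); rewrite size_map // => i lti.
rewrite (nth_map 0) //; set x := nth 0 p i.
have : x \in iota 1 (size p) by rewrite -(perm_mem perm_p) mem_nth.
rewrite mem_iota (permP perm_p) => /andP[x_gt0 x_le].
rewrite -{1}(subnKC (_ : x <= size p)); last by lia.
rewrite iotaD count_cat.
have /eqP-> : count (leq^~ x) (iota 1 x) == size (iota 1 x).
  by rewrite -all_count; apply/allP => y; rewrite mem_iota; lia.
rewrite size_iota (_ : count _ _ = 0) ?addn0 //.
apply/eqP; rewrite -leqn0 leqNgt -has_count; apply/hasPn => y.
by rewrite mem_iota; lia.
Qed.

Lemma is_perm_uniq (p : seq nat) : is_perm p -> uniq p.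
Proof. by move/perm_uniq->; apply: iota_uniq. Qed.

(** Positions are counted from 0 here.  For i <= size s the equality fails by
    itself when the window sticks out of s; beyond the end of s, the empty pattern
    would still match. *)
Definition occurs (p s : seq nat) (i : nat) : bool :=
  rho (take (size p) (drop i s)) == p.

Lemma occursP (p s : seq nat) (i : nat) : is_perm p -> i <= size s ->
  reflect (i + size p <= size s /\
           {in [pred u | u < size p] &, forall u v,
             (nth 0 s (i + u) <= nth 0 s (i + v)) = (nth 0 p u <= nth 0 p v)})
          (occurs p s i).
Proof.
move=> perm_p le_i; rewrite /occurs -[X in _ == X]rho_perm //.
apply: (iffP eqP) => [/rho_order_iso[]|[le_p eq_le]].
  rewrite size_take_min size_drop => eq_size eq_le; split; first by lia.
  move=> u v; rewrite !inE => ltu ltv.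
  rewrite -eq_le ?inE ?size_take_min ?size_drop ?eq_size //.
  by rewrite !nth_take ?nth_drop.
apply/rho_order_iso; rewrite /order_iso size_takel ?size_drop; last by lia.
split=> // u v ltu ltv; rewrite !nth_take ?nth_drop //; exact: eq_le.
Qed.

(** This turns the absence of redundancies into a restriction on windows: those of
    two different patterns are never nested. *)
Lemma occurs_nested (p q s : seq nat) (i j : nat) :
  is_perm p -> is_perm q -> j + size q <= size s ->
  occurs p s i -> occurs q s j ->
  i <= j -> j + size q <= i + size p -> contains p q.
Proof.
move=> perm_p perm_q le_s occ_p occ_q le_ij le_qp.
have le_is : i <= size s by lia.
have le_js : j <= size s by lia.
have [le_ps eq_p] := occursP perm_p le_is occ_p.
have [_ eq_q] := occursP perm_q le_js occ_q.
exists (j - i).+1; rewrite mem_filter mem_iota /= -/(occurs q p (j - i)).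
apply/andP; split; last by lia.
apply/occursP => //; first by lia.
split=> [|u v]; first by lia.
rewrite !inE => ltu ltv; rewrite -eq_p ?inE; [|by lia|by lia].
rewrite -eq_q ?inE //; congr (nth 0 s _ <= nth 0 s _); lia.
Qed.

(** * Overlap maps *)

(** An overlap map is recorded as a bare set, but its cardinality gives back the
    length of the overlap. *)
Lemma card_OverlapMap (p q : seq nat) (j : nat) : uniq q ->
  j <= size p -> j <= size q -> #|` OverlapMap p q j| = j.
Proof.
move=> uniq_q le_p le_q; rewrite /OverlapMap card_fseq undup_id.
  by rewrite size_zip size_takel ?size_drop // subKn // minnn.
apply: (@map_uniq _ _ fst); rewrite -/(unzip1 _) unzip1_zip ?take_uniq //.
by rewrite size_takel // size_drop subKn.
Qed.

Lemma mem_OverlapMap (p q : seq nat) (j : nat) (x : nat * nat) :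
  j <= size p -> j <= size q ->
  reflect (exists2 u, u < j & x = (nth 0 q u, nth 0 p (size p - j + u)))
          (x \in OverlapMap p q j).
Proof.
move=> le_p le_q; have eq_size : size (take j q) = size (drop (size p - j) p).
  by rewrite size_takel // size_drop; lia.
have size_z : size (zip (take j q) (drop (size p - j) p)) = j.
  by rewrite size1_zip -?eq_size ?size_takel.
rewrite inE; apply: (iffP (nthP (0, 0))) => -[u].
  rewrite size_z => ltu <-; exists u => //.
  by rewrite nth_zip // nth_take // nth_drop.
by move=> ltu ->; exists u; rewrite ?size_z // nth_zip // nth_take // nth_drop.
Qed.

(** Since the length of an overlap can be read off its map, equality of the sets
    of all overlap maps gives equality length by length. *)
Lemma eq_OverlapMap (p q p' q' : seq nat) (j : nat) :
  uniq q -> uniq q' -> size p = size p' -> size q = size q' ->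
  OverlapMaps p q = OverlapMaps p' q' ->
  0 < j -> j < size p -> j < size q ->
  rho (drop (size p - j) p) = rho (take j q) ->
  OverlapMap p q j = OverlapMap p' q' j.
Proof.
move=> uniq_q uniq_q' eq_p eq_q eq_maps j_gt0 lt_p lt_q eq_rho.
have : OverlapMap p q j \in OverlapMaps p' q'.
  rewrite -eq_maps inE; apply: map_f.
  by rewrite mem_filter eq_rho eqxx mem_iota /=; lia.
rewrite inE => /mapP[j']; rewrite mem_filter mem_iota => /andP[_ lt_j'] eq_map.
have := congr1 (fun X : {fset nat * nat} => #|` X|) eq_map.
rewrite !card_OverlapMap //; try by lia.
by move=> eq_j; rewrite eq_map eq_j.
Qed.

(** The suffix of p and the prefix of q that overlap share their positions.  The
    entries of p and q at a shared position form a pair of the overlap map, and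
    so do the entries of p' and q' at a shared position.  Hence following the
    entry of p into p' and the entry of q into q' leads to one and the same shared
    position. *)
Lemma OverlapMap_index (p q p' q' : seq nat) (j u : nat) :
  uniq p' -> uniq q' -> size p = size p' -> size q = size q' ->
  OverlapMap p q j = OverlapMap p' q' j ->
  j <= size p -> j <= size q -> u < j ->
  index (nth 0 p (size p - j + u)) p' =
    (size p - j + index (nth 0 q u) q')%N.
Proof.
move=> uniq_p' uniq_q' eq_p eq_q eq_map le_p le_q ltu.
have : (nth 0 q u, nth 0 p (size p - j + u)) \in OverlapMap p' q' j.
  by rewrite -eq_map; apply/mem_OverlapMap => //; exists u.
have le_p' : j <= size p' by lia.
have le_q' : j <= size q' by lia.
case/(mem_OverlapMap _ le_p' le_q') => v ltv [-> ->].
have lt_p' : (size p' - j + v < size p')%N by lia.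
have lt_q' : v < size q' by lia.
by rewrite (index_uniq _ lt_p' uniq_p') (index_uniq _ lt_q' uniq_q') eq_p.
Qed.

(** * Marks that occur together *)

(** As every pattern contains itself in the sense of [contains], the second clause
    also says that different indices carry different patterns. *)
Definition antichain (I : finType) (p : I -> seq nat) : Prop :=
  (forall a, is_perm (p a)) /\ (forall a b, contains (p a) (p b) -> a = b).

Definition same_overlaps (I : finType) (p q : I -> seq nat) : Prop :=
  (forall a, size (p a) = size (q a)) /\
  (forall a b, OverlapMaps (p a) (p b) = OverlapMaps (q a) (q b)).

Lemma same_overlaps_sym (I : finType) (p q : I -> seq nat) :
  same_overlaps p q -> same_overlaps q p.
Proof. by case=> eq_size eq_maps; split=> *; rewrite (eq_size, eq_maps). Qed.

Definition marks (I : finType) (n : nat) (p : I -> seq nat) (s : seq nat) :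
    {set I * 'I_n.+1} :=
  [set m : I * 'I_n.+1 | occurs (p m.1) s m.2].

Definition covers (I : finType) (n : nat) (p : I -> seq nat)
    (m : I * 'I_n.+1) (x : nat) : bool :=
  m.2 <= x < m.2 + size (p m.1).

(** This permutes the positions of one window in such a way that entries ordered
    like the pattern from p become ordered like the one from q. *)
Definition move_in (I : finType) (n : nat) (p q : I -> seq nat)
    (m : I * 'I_n.+1) (x : nat) : nat :=
  m.2 + index (nth 0 (p m.1) (x - m.2)) (q m.1).

(** The part of an overlap of windows that the relabelling depends on, stated so
    that p and q can be exchanged; j is the length of the overlap. *)
Definition linked (I : finType) (n : nat) (p q : I -> seq nat)
    (m m' : I * 'I_n.+1) : Prop :=
  exists j, [/\ j <= size (p m.1), j <= size (p m'.1),
                (m.2 + size (p m.1) = m'.2 + j)%N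
              & OverlapMap (p m.1) (p m'.1) j = OverlapMap (q m.1) (q m'.1) j].

Lemma linked_sym (I : finType) (n : nat) (p q : I -> seq nat)
    (m m' : I * 'I_n.+1) :
  (forall a, size (p a) = size (q a)) -> linked p q m m' -> linked q p m m'.
Proof. by move=> eq_size [j []]; rewrite !eq_size; exists j; split. Qed.

Lemma linked_move_in (I : finType) (n : nat) (p q : I -> seq nat)
    (m m' : I * 'I_n.+1) (x : nat) :
  (forall a, is_perm (q a)) -> (forall a, size (p a) = size (q a)) ->
  linked p q m m' -> covers p m x -> covers p m' x ->
  move_in p q m x = move_in p q m' x.
Proof.
move=> perm_q eq_size [j [le_j le_j' eq_end eq_map]] /andP[lo hi] /andP[lo' hi'].
rewrite /move_in (_ : x - m.2 = size (p m.1) - j + (x - m'.2))%N; last by lia.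
rewrite (OverlapMap_index _ _ _ _ eq_map) ?is_perm_uniq //; lia.
Qed.

(** Two occurrences in one permutation compare the entries of the overlap in the
    same way, since both compare them as s does; this is the condition for the
    overlap to have an overlap map. *)
Lemma occurrences_linked (I : finType) (n : nat) (p q : I -> seq nat)
    (s : seq nat) (m m' : I * 'I_n.+1) :
  antichain p -> (forall a, is_perm (q a)) -> same_overlaps p q ->
  size s = n -> m \in marks n p s -> m' \in marks n p s ->
  m.2 <= m'.2 -> m'.2 < m.2 + size (p m.1) -> m = m' \/ linked p q m m'.
Proof.
move=> [perm_p anti_p] perm_q [eq_size eq_maps] size_s.
case: m => a i; case: m' => b k; rewrite !inE /= => occ_a occ_b le_ik lt_k.
have le_i : i <= size s by rewrite size_s -ltnS.
have le_k : k <= size s by rewrite size_s -ltnS.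
have [le_as iso_a] := occursP (perm_p a) le_i occ_a.
have [le_bs iso_b] := occursP (perm_p b) le_k occ_b.
(* Nested windows, one way or the other, force a = b and then i = k. *)
have [le_ba | lt_ab] := leqP (k + size (p b)) (i + size (p a)).
  left; have eq_ab : a = b.
    by apply/anti_p/(occurs_nested _ _ le_bs occ_a occ_b).
  by congr (_, _) => //; apply: val_inj => /=; rewrite eq_ab in le_ba; lia.
have [eq_ik | ne_ik] := eqVneq (i : nat) (k : nat).
  left; have eq_ab : b = a.
    by apply/anti_p/(occurs_nested _ _ le_as occ_b occ_a) => //; lia.
  by congr (_, _) => //; apply: val_inj.
right; exists (i + size (p a) - k); split=> /=; try lia.
set j := i + size (p a) - k.
apply: eq_OverlapMap; rewrite ?is_perm_uniq //; try lia.
apply/rho_order_iso; split=> [|u v].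
  by rewrite size_drop size_takel; lia.
rewrite !inE size_drop => ltu ltv; rewrite !nth_drop !nth_take; try lia.
rewrite -iso_a ?inE -?iso_b ?inE; try lia.
by congr (nth 0 s _ <= nth 0 s _); lia.
Qed.

Lemma occurrences_agree (I : finType) (n : nat) (p q : I -> seq nat)
    (s : seq nat) (m m' : I * 'I_n.+1) (x : nat) :
  antichain p -> (forall a, is_perm (q a)) -> same_overlaps p q ->
  size s = n -> m \in marks n p s -> m' \in marks n p s ->
  covers p m x -> covers p m' x ->
  move_in p q m x = move_in p q m' x /\ move_in q p m x = move_in q p m' x.
Proof.
move=> anti_p perm_q same size_s; wlog le_mm' : m m' / m.2 <= m'.2.
  move=> hwlog mA mA' cov cov'.
  case/orP: (leq_total m.2 m'.2) => le_mm'; first exact: hwlog.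
  by have [-> ->] := hwlog _ _ le_mm' mA' mA cov' cov.
move=> mA mA' cov cov'; have [eq_size _] := same.
have lt_m' : m'.2 < m.2 + size (p m.1).
  by case/andP: cov cov' => _ hi /andP[lo _]; apply: leq_ltn_trans lo hi.
case: (occurrences_linked anti_p perm_q same size_s mA mA' le_mm' lt_m').
  by move=> ->.
move=> link; split; first exact: linked_move_in link cov cov'.
apply: linked_move_in (linked_sym eq_size link) _ _ => //.
- by case: anti_p.
- by rewrite /covers -eq_size.
- by rewrite /covers -eq_size.
Qed.

(** * Relabelling positions *)

Definition relabel (I : finType) (n : nat) (p q : I -> seq nat)
    (A : {set I * 'I_n.+1}) (x : nat) : nat :=
  if [pick m in A | covers p m x] is Some m then move_in p q m x else x.

(** This makes [relabel] independent of the mark that it picks. *)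
Definition coherent (I : finType) (n : nat) (p q : I -> seq nat)
    (A : {set I * 'I_n.+1}) : Prop :=
  forall m m' x, m \in A -> m' \in A -> covers p m x -> covers p m' x ->
    move_in p q m x = move_in p q m' x.

Lemma relabel_covered (I : finType) (n : nat) (p q : I -> seq nat)
    (A : {set I * 'I_n.+1}) (m : I * 'I_n.+1) (x : nat) :
  coherent p q A -> m \in A -> covers p m x ->
  relabel p q A x = move_in p q m x.
Proof.
rewrite /relabel => coh mA cov; case: pickP => [m' /andP[mA' cov'] | /(_ m)].
  exact: coh.
by rewrite mA cov.
Qed.

Lemma move_in_covers (I : finType) (n : nat) (p q : I -> seq nat)
    (m : I * 'I_n.+1) (x : nat) :
  (forall a, is_perm (p a)) -> (forall a, is_perm (q a)) ->
  (forall a, size (p a) = size (q a)) ->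
  covers p m x -> covers q m (move_in p q m x).
Proof.
move=> perm_p perm_q eq_size /andP[lo hi].
have lt_x : x - m.2 < size (p m.1) by lia.
rewrite /covers /move_in leq_addr ltn_add2l index_mem.
by rewrite (perm_mem (perm_q _)) -eq_size -(perm_mem (perm_p _)) mem_nth.
Qed.

Lemma move_inK (I : finType) (n : nat) (p q : I -> seq nat)
    (m : I * 'I_n.+1) (x : nat) :
  (forall a, is_perm (p a)) -> (forall a, is_perm (q a)) ->
  (forall a, size (p a) = size (q a)) ->
  covers p m x -> move_in q p m (move_in p q m x) = x.
Proof.
move=> perm_p perm_q eq_size cov; have /andP[lo hi] := cov.
have := move_in_covers perm_p perm_q eq_size cov.
rewrite /covers /move_in leq_addr ltn_add2l index_mem addKn => mem_q.
have lt_x : x - m.2 < size (p m.1) by lia.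
by rewrite nth_index // (index_uniq _ lt_x) ?is_perm_uniq // subnKC.
Qed.

Lemma relabelK (I : finType) (n : nat) (p q : I -> seq nat)
    (A : {set I * 'I_n.+1}) :
  (forall a, is_perm (p a)) -> (forall a, is_perm (q a)) ->
  (forall a, size (p a) = size (q a)) ->
  coherent p q A -> coherent q p A ->
  cancel (relabel p q A) (relabel q p A).
Proof.
move=> perm_p perm_q eq_size coh_pq coh_qp x.
rewrite {2}/relabel; case: pickP => [m /andP[mA cov] | no_cover].
  rewrite (relabel_covered coh_qp mA) ?move_inK //.
  exact: move_in_covers.
rewrite /relabel; case: pickP => // m; have := no_cover m.
by rewrite /covers eq_size => ->.
Qed.

Lemma relabel_lt (I : finType) (n : nat) (p q : I -> seq nat)
    (A : {set I * 'I_n.+1}) (x : nat) :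
  (forall a, is_perm (p a)) -> (forall a, is_perm (q a)) ->
  (forall a, size (p a) = size (q a)) ->
  (forall m, m \in A -> m.2 + size (p m.1) <= n) ->
  x < n -> relabel p q A x < n.
Proof.
move=> perm_p perm_q eq_size fits lt_x.
rewrite /relabel; case: pickP => // m /andP[mA cov].
have /andP[_] := move_in_covers perm_p perm_q eq_size cov.
by rewrite -eq_size => /leq_trans; apply; apply: fits.
Qed.

Definition permute (n : nat) (f : nat -> nat) (s : seq nat) : seq nat :=
  [seq nth 0 s (f y) | y <- iota 0 n].

Lemma nth_permute (n : nat) (f : nat -> nat) (s : seq nat) (y : nat) :
  y < n -> nth 0 (permute n f s) y = nth 0 s (f y).
Proof. by move=> lt_y; rewrite (nth_map 0) ?size_iota // nth_iota. Qed.

Lemma perm_permute (n : nat) (f : nat -> nat) (s : seq nat) :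
  injective f -> (forall y, y < n -> f y < n) -> size s = n ->
  perm_eq (permute n f s) s.
Proof.
move=> inj_f lt_f size_s; rewrite -[X in perm_eq _ X](mkseq_nth 0 s) size_s.
rewrite /permute /mkseq (map_comp (nth 0 s) f); apply: perm_map.
have uniq_f : uniq (map f (iota 0 n)) by rewrite map_inj_uniq ?iota_uniq.
apply: uniq_perm; rewrite ?iota_uniq //.
apply: (uniq_min_size uniq_f _ _).2; last by rewrite size_map.
by move=> _ /mapP[y + ->]; rewrite !mem_iota => /lt_f.
Qed.

(** In the relabelled permutation, the entry of the window of (a, i) where q a has
    the value v is the entry of s where p a has the value v.  So the window is
    ordered like q a because it was ordered like p a. *)
Lemma permute_occurs (I : finType) (n : nat) (p q : I -> seq nat)
    (A : {set I * 'I_n.+1}) (s : seq nat) :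
  (forall a, is_perm (p a)) -> (forall a, is_perm (q a)) ->
  (forall a, size (p a) = size (q a)) -> coherent q p A -> size s = n ->
  A \subset marks n p s -> A \subset marks n q (permute n (relabel q p A) s).
Proof.
move=> perm_p perm_q eq_size coh size_s /subsetP sub; apply/subsetP => m mA.
have := sub m mA; rewrite !inE => /occursP[//||le_ms iso].
  by rewrite size_s -ltnS.
rewrite size_s in le_ms; have size_t : size (permute n (relabel q p A) s) = n.
  by rewrite size_map size_iota.
have eq_t u : u < size (q m.1) ->
    nth 0 (permute n (relabel q p A) s) (m.2 + u) =
    nth 0 s (m.2 + index (nth 0 (q m.1) u) (p m.1)).
  move=> ltu; have lt_n : m.2 + u < n.
    by apply: leq_trans le_ms; rewrite ltn_add2l eq_size.
  rewrite nth_permute //.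
  rewrite (relabel_covered coh mA) /move_in ?addKn //.
  by rewrite /covers leq_addr ltn_add2l.
have mem_p u : u < size (q m.1) -> nth 0 (q m.1) u \in p m.1.
  move=> ltu; rewrite (perm_mem (perm_p _)) eq_size -(perm_mem (perm_q _)).
  exact: mem_nth.
apply/occursP; rewrite ?size_t //; first by rewrite -ltnS.
split; first by rewrite -eq_size.
move=> u v; rewrite !inE => ltu ltv.
rewrite !eq_t // iso ?inE ?index_mem ?mem_p //.
by rewrite !nth_index ?mem_p.
Qed.

(** If some permutation s0 has all the marks of A, these are pairwise compatible and
    the relabelling is a bijection of the positions, which acts injectively on all
    permutations with these marks.  Otherwise the left side is 0. *)
Lemma leq_count_marks (I : finType) (n : nat) (p q : I -> seq nat)
    (A : {set I * 'I_n.+1}) :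
  antichain p -> (forall a, is_perm (q a)) -> same_overlaps p q ->
  count (fun s => A \subset marks n p s) (permutations (iota 1 n)) <=
  count (fun s => A \subset marks n q s) (permutations (iota 1 n)).
Proof.
move=> anti_p perm_q same; have [perm_p _] := anti_p; have [eq_size _] := same.
set S := permutations _.
have [/hasP[s0 s0S sub0] | ] := boolP (has (fun s => A \subset marks n p s) S);
  last by rewrite has_count -leqNgt leqn0 => /eqP->.
have size_S s : s \in S -> size s = n.
  by rewrite mem_permutations => /perm_size->; rewrite size_iota.
have size0 := size_S _ s0S; have sub0' := subsetP sub0.
have coh_pq : coherent p q A.
  move=> m m' x mA mA' cov cov'.
  by have [] := occurrences_agree anti_p perm_q same size0
    (sub0' _ mA) (sub0' _ mA') cov cov'.
have coh_qp : coherent q p A.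
  move=> m m' x mA mA' cov cov'.
  have [||_ ->//] := occurrences_agree anti_p perm_q same size0
    (sub0' _ mA) (sub0' _ mA') (_ : covers p m x) (_ : covers p m' x).
  - by rewrite /covers eq_size.
  - by rewrite /covers eq_size.
have fits m : m \in A -> m.2 + size (q m.1) <= n.
  move=> mA; have := sub0' _ mA; rewrite inE -eq_size => /occursP[//||].
    by rewrite size0 -ltnS.
  by rewrite size0.
have eq_size' a : size (q a) = size (p a) by rewrite eq_size.
have f_K : cancel (relabel q p A) (relabel p q A) by apply: relabelK.
have f_lt y : y < n -> relabel q p A y < n by apply: relabel_lt.
have g_lt x : x < n -> relabel p q A x < n.
  by apply: relabel_lt => // m mA; rewrite eq_size; apply: fits.
have g_K : cancel (relabel p q A) (relabel q p A) by apply: relabelK.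
set F := permute n (relabel q p A).
rewrite -!size_filter -(size_map F); apply: uniq_leq_size.
  rewrite map_inj_in_uniq ?filter_uniq ?permutations_uniq //.
  move=> s t; rewrite !mem_filter => /andP[_ sS] /andP[_ tS] eq_F.
  apply: (@eq_from_nth _ 0); rewrite !size_S // => x lt_x.
  have nth_F r : nth 0 (F r) (relabel p q A x) = nth 0 r x.
    by rewrite nth_permute ?g_lt // g_K.
  by rewrite -nth_F eq_F nth_F.
move=> _ /mapP[s + ->]; rewrite !mem_filter => /andP[sub sS].
rewrite permute_occurs ?size_S //= mem_permutations.
apply: (perm_trans (perm_permute (can_inj f_K) f_lt (size_S _ sS))).
by rewrite -mem_permutations.
Qed.

(** * Distribution of the set of marks *)

(** Downward induction on A: the number of entries equal to A is the number of
    those that include A minus the numbers of those equal to a larger set. *)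
Lemma perm_eq_of_upsets (T : finType) (X Y : seq {set T}) :
  (forall A : {set T},
     count (fun Z : {set T} => A \subset Z) X =
     count (fun Z : {set T} => A \subset Z) Y) ->
  perm_eq X Y.
Proof.
move=> eq_up; apply/allP => A _; apply/eqP.
have [k] := ubnP #|~: A|%SET; elim: k A => // k IHk A lt_A.
have count_up Z : count (fun C : {set T} => A \subset C) Z =
    (count_mem A Z + \sum_(C : {set T} | A \proper C) count_mem C Z)%N.
  elim: Z => [|B Z IHZ] /=; first by rewrite big1.
  rewrite IHZ big_split /= addnACA; congr addn.
  rewrite subEproper eq_sym; case: eqVneq => [-> | _] /=.
    by rewrite big1 // => C; case: eqVneq => // ->; rewrite properxx.
  have [prop | nprop] := boolP (A \proper B).
    rewrite (bigD1 B) //= eqxx big1 // => C /andP[_ /negbTE].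
    by rewrite eq_sym => ->.
  by rewrite big1 // => C; case: eqVneq nprop => // ->; move=> /negbTE->.
apply/eqP; have := eq_up A; rewrite !count_up => /eqP.
rewrite (eq_bigr (fun C => count_mem C Y)) ?eqn_add2r // => C prop.
apply: IHk; rewrite -ltnS; apply: leq_trans lt_A; rewrite ltnS.
by apply: proper_card; rewrite properC.
Qed.

Lemma perm_eq_marks (I : finType) (n : nat) (p q : I -> seq nat) :
  antichain p -> antichain q -> same_overlaps p q ->
  perm_eq (map (marks n p) (permutations (iota 1 n)))
          (map (marks n q) (permutations (iota 1 n))).
Proof.
move=> anti_p anti_q same; have [perm_p _] := anti_p; have [perm_q _] := anti_q.
apply: perm_eq_of_upsets => A; rewrite !count_map; apply/eqP.
by rewrite eqn_leq !leq_count_marks //; apply: same_overlaps_sym.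
Qed.

(** A pattern never fits at the positions that the definition of occurrences leaves
    out, so all positions up to n may be tested. *)
Lemma size_occurrences (n : nat) (p s : seq nat) :
  size s = n -> size (occurrences p s) = (\sum_(i < n.+1 | occurs p s i) 1)%N.
Proof.
move=> size_s; rewrite -(big_mkord (occurs p s) (fun _ => 1%N)).
rewrite /occurrences size_filter size_s.
rewrite -(addn0 1) iotaDl count_map -sum1_count.
rewrite -[X in iota 0 X]subn0 -/(index_iota 0 _).
rewrite (big_nat_widen _ _ n.+1) ?leq_subr //.
rewrite big_nat_cond [RHS]big_nat_cond; apply: eq_bigl => i /=.
rewrite add0n -/(occurs p s i); case: ltnP => //= lt_i.
have [occ | _] //= := boolP (occurs p s i); move/eqP: occ => /(congr1 size).
by rewrite size_map size_take_min size_drop size_s => /minn_idPl; lia.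
Qed.

Lemma num_occurrences_marks (I : finType) (n : nat) (p : I -> seq nat)
    (B : {fset seq nat}) (s : seq nat) :
  injective p -> B = [fset p a | a in I] -> size s = n ->
  num_occurrences B s = #|marks n p s|.
Proof.
move=> inj_p -> size_s; rewrite /num_occurrences.
rewrite (perm_big [seq p a | a <- enum I]); last first.
  apply: uniq_perm => [||x]; rewrite ?fset_uniq //.
    by rewrite (map_inj_uniq inj_p) enum_uniq.
  apply/imfsetP/mapP => [[a _ ->]|[a _ ->]]; by exists a; rewrite // mem_enum.
rewrite big_map big_enum /= -sum1_card.
under eq_bigr do rewrite (size_occurrences _ size_s).
by rewrite pair_big_dep; apply: eq_bigl => -[a i]; rewrite !inE.
Qed.

Lemma antichain_of_fset (I : finType) (p : I -> seq nat) (B : {fset seq nat}) :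
  injective p -> B = [fset p a | a in I] ->
  (forall x, x \in B -> is_perm x) -> no_redundancies B -> antichain p.
Proof.
move=> inj_p eq_B perm_B red_B.
have mem_B a : p a \in B by rewrite eq_B; apply/imfsetP; exists a.
split=> [a | a b cont]; first exact: perm_B.
apply: inj_p; apply/eqP/negP => /negP ne_ab.
by apply: red_B; exists (p a), (p b); split=> //; apply/eqP.
Qed.

Theorem theorem2 (B B' : {fset seq nat})
  (permB : forall p : seq nat, p \in B -> is_perm p)
  (permB' : forall p : seq nat, p \in B' -> is_perm p)
  (cardBB' : #|` B| = #|` B'|)
  (redB : no_redundancies B)
  (redB' : no_redundancies B')
  (labeling : exists (k : nat) (p p' : 'I_k -> seq nat),
    [/\ injective p /\ injective p',
        B = [fset p i | i in 'I_k] /\ B' = [fset p' i | i in 'I_k],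
        forall i : 'I_k, size (p i) = size (p' i)
      & forall i j : 'I_k,
          OverlapMaps (p i) (p j) = OverlapMaps (p' i) (p' j)]) :
  strongly_cWilf_equivalent B B'.
Proof.
have [k [p [q [[inj_p inj_q] [eq_B eq_B'] eq_size eq_maps]]]] := labeling.
have anti_p := antichain_of_fset inj_p eq_B permB redB.
have anti_q := antichain_of_fset inj_q eq_B' permB' redB'.
have same : same_overlaps p q by [].
apply: boolp.funext => n; apply: boolp.funext => l.
rewrite /P_series; congr ((_ %:R) / _)%R.
set S := permutations (iota 1 n).
have num_marks (C : {fset seq nat}) (r : 'I_k -> seq nat) :
    injective r -> C = [fset r a | a in 'I_k] ->
    num_perms C l n =
    count (fun Z : {set 'I_k * 'I_n.+1} => #|Z| == l) (map (marks n r) S).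
  move=> inj_r eq_C; rewrite count_map; apply: eq_in_count => s.
  rewrite mem_permutations => /perm_size; rewrite size_iota => size_s /=.
  by rewrite (num_occurrences_marks inj_r eq_C size_s).
by rewrite (num_marks B p) // (num_marks B' q) //; apply/permP/perm_eq_marks.
Qed.
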